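(* Let $X$ be a complex Banach space, let $m\ge1$ be an integer, and let $T\in B(X)$ have property $(GFS)_m$. Then $T$ is power bounded, i.e. $\sup_{n\ge1}\|T^n\|<\infty$.
   Context: $\overline{\mathbb{D}}$ is the closed unit disc, $\sigma(T)$ the spectrum of $T$, $R(\lambda,T)=(\lambda I_X-T)^{-1}$. $T\in B(X)$ has property $(GFS)_m$ if $\sigma(T)\subset\overline{\mathbb{D}}$ and there is $C>0$ such that for all $r>1$, $x\in X$, $x^*\in X^*$, $$\int_0^{2\pi}|\langle R(re^{it},T)^{m+1}x,x^*\rangle|\,dt\le\frac{C}{(r+1)(r-1)^m}\|x\|\,\|x^*\|.$$ *)

(* Defs.v *)
From Stdlib Require Import Reals ClassicalEpsilon.
From Coquelicot Require Import Coquelicot.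

Open Scope R_scope.

(* Bounded linear maps are plain functions satisfying Coquelicot's [is_linear],
   which includes the existence of a bound; elements of the dual of [X] are
   the [f : X -> C_NormedModule] with [is_linear f]. *)

(* The supremum over the closed unit ball. It is finite when [is_linear A];
   [real] would turn an infinite supremum into 0. *)
Definition op_norm {U V : NormedModule C_AbsRing} (A : U -> V) : R :=
  real (Lub_Rbar (fun y => exists x : U, norm x <= 1 /\ y = norm (A x))).

Section Operators.

Context {X : CompleteNormedModule C_AbsRing}.

Definition shifted (l : C) (T : X -> X) : X -> X :=
  fun x => minus (scal l x) (T x).

Definition is_bounded_inverse (A S : X -> X) : Prop :=
  is_linear S /\ (forall x, S (A x) = x) /\ (forall x, A (S x) = x).

Definition spectrum (T : X -> X) (l : C) : Prop :=
  ~ exists S, is_bounded_inverse (shifted l T) S.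

(* Arbitrary when [l] lies in the spectrum; otherwise the inverse is unique. *)
Definition resolvent (l : C) (T : X -> X) : X -> X :=
  epsilon (inhabits (fun x => x)) (is_bounded_inverse (shifted l T)).

Definition op_pow (A : X -> X) (n : nat) : X -> X := fun x => Nat.iter n A x.

Definition circle_point (r t : R) : C := Cmult (RtoC r) (cos t, sin t).

(* Once the spectrum lies in the closed unit disc, the integrand is continuous
   in [t] for every [r > 1], so the total [RInt] is a genuine integral. *)
Definition GFS (m : nat) (T : X -> X) : Prop :=
  (forall l : C, spectrum T l -> Cmod l <= 1) /\
  exists K : R, 0 < K /\
    forall (r : R) (x : X) (f : X -> C_NormedModule),
      1 < r -> is_linear f ->
      RInt (fun t => Cmod (f (op_pow (resolvent (circle_point r t) T) (m + 1) x)))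
           0 (2 * PI)
      <= K / ((r + 1) * (r - 1) ^ m) * norm x * op_norm f.

Definition power_bounded (T : X -> X) : Prop :=
  exists M : R, forall n : nat, (1 <= n)%nat -> op_norm (op_pow T n) <= M.

End Operators.

(* Main.v *)
Require Import Defs.
From Stdlib Require Import Reals Lra Lia List Arith Factorial Classical ClassicalEpsilon.
From Coquelicot Require Import Coquelicot.
From mathcomp Require classical_sets.

Set Bullet Behavior "Strict Subproofs".

(* With [l = r e^(it)] and [f] in the dual, let [M(N, k) = int_0^(2 pi) Re (l^N f(R(l,T)^k x)) dt].
   Since [d/dl R^k = - k R^(k+1)], integrating the derivative of [l^N R^k] around the circle gives
   [k M(N+1, k+1) = N M(N, k)], so that [M(n+m+1, m+1) = C(n+m, m) M(n+1, 1)].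
   The identity [l R x = x + R T x] reduces [M(n+1, 1)] to [2 pi Re f(T^n x)] plus a term [M(0, 1)],
   which vanishes because it is independent of [r] and tends to 0 as [r] tends to infinity.
   Hence [2 pi C(n+m, m) Re f(T^n x)] is at most [r^(n+m+1)] times the integral bounded by the
   hypothesis; choosing [r = 1 + 1/(n+1)] makes the powers of [n] cancel, and the Hahn-Banach
   theorem passes from [f(T^n x)] to the norm of [T^n x]. *)

(** Everything is tested against a functional, so only real integrals of [Re] of scalar functions on
    circles occur; real parts lose nothing because the norming functional satisfies
    [Re (f y) = norm y]. Each integration by parts trades one of the [m + 1] resolvent factors for a
    factor that grows like [n], so after [m] steps [C(n+m, m) >= (n+1)^m / m!] has been gained. This
    is exactly what the hypothesis loses at [r = 1 + 1/(n+1)], where [(r-1)^(-m) = (n+1)^m]. The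
    remaining factor is harmless: [r^(n+1) <= e] and [r^m <= 2^m]. The same device, a derivative
    along a closed circle integrates to zero, yields the integration by parts, the vanishing of
    [int l^N dt] for [N >= 1], and the independence of [M(0, 1)] from [r]. *)

(** * Vector identities by reflection *)

Inductive vexpr :=
| VVar (n : nat) | VZero | VPlus (a b : vexpr) | VScal (c : C) (a : vexpr) | VOpp (a : vexpr).

Fixpoint vexpr_den {X : ModuleSpace C_Ring} (env : list X) (e : vexpr) : X :=
  match e with
  | VVar n => nth n env zero
  | VZero => zero
  | VPlus a b => plus (vexpr_den env a) (vexpr_den env b)
  | VScal c a => scal c (vexpr_den env a)
  | VOpp a => opp (vexpr_den env a)
  end.

Fixpoint vexpr_coef (e : vexpr) (i : nat) : C :=
  match e with
  | VVar n => if Nat.eqb n i then RtoC 1 else RtoC 0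
  | VZero => RtoC 0
  | VPlus a b => Cplus (vexpr_coef a i) (vexpr_coef b i)
  | VScal c a => Cmult c (vexpr_coef a i)
  | VOpp a => Copp (vexpr_coef a i)
  end.

(** Coefficients form a function on indices, so sums and multiples are pointwise. Those beyond the
    length of [env] are ignored, in agreement with the default [zero] of [nth] in [vexpr_den]. *)
Fixpoint lin_comb {X : ModuleSpace C_Ring} (env : list X) (c : nat -> C) : X :=
  match env with
  | nil => zero
  | x :: l => plus (scal (c O) x) (lin_comb l (fun n => c (S n)))
  end.

Lemma lin_comb_ext {X : ModuleSpace C_Ring} (env : list X) (c d : nat -> C) :
  (forall i, c i = d i) -> lin_comb env c = lin_comb env d.
Proof.
  revert c d; induction env as [|x l IH]; intros c d H; simpl.
  - reflexivity.
  - rewrite (H O). f_equal. apply IH. intros i; apply H.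
Qed.

Lemma lin_comb_zero {X : ModuleSpace C_Ring} (env : list X) :
  lin_comb env (fun _ => RtoC 0) = zero.
Proof.
  induction env as [|x l IH]; simpl.
  - reflexivity.
  - rewrite IH, plus_zero_r. exact (scal_zero_l x).
Qed.

Lemma lin_comb_plus {X : ModuleSpace C_Ring} (env : list X) (c d : nat -> C) :
  lin_comb env (fun i => Cplus (c i) (d i)) = plus (lin_comb env c) (lin_comb env d).
Proof.
  revert c d; induction env as [|x l IH]; intros c d; simpl.
  - now rewrite plus_zero_l.
  - rewrite (IH (fun n => c (S n)) (fun n => d (S n))).
    change (Cplus (c O) (d O)) with (@plus C_Ring (c O) (d O)).
    rewrite scal_distr_r, <- !plus_assoc. f_equal.
    rewrite !plus_assoc. f_equal. apply plus_comm.
Qed.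

Lemma lin_comb_scal {X : ModuleSpace C_Ring} (env : list X) (k : C) (c : nat -> C) :
  lin_comb env (fun i => Cmult k (c i)) = scal k (lin_comb env c).
Proof.
  revert c; induction env as [|x l IH]; intros c; simpl.
  - symmetry; exact (scal_zero_r (V := X) k).
  - rewrite (IH (fun n => c (S n))).
    rewrite (scal_distr_l k), (scal_assoc k). reflexivity.
Qed.

Lemma lin_comb_var {X : ModuleSpace C_Ring} (env : list X) (n : nat) :
  lin_comb env (fun i => if Nat.eqb n i then RtoC 1 else RtoC 0) = nth n env zero.
Proof.
  revert n; induction env as [|x l IH]; intros n; simpl.
  - now destruct n.
  - destruct n as [|n]; simpl.
    + rewrite lin_comb_zero, plus_zero_r. exact (scal_one x).
    + rewrite IH. rewrite (scal_zero_l (K := C_Ring) x : scal (RtoC 0) x = zero). apply plus_zero_l.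
Qed.

Lemma vexpr_den_coef {X : ModuleSpace C_Ring} (env : list X) (e : vexpr) :
  vexpr_den env e = lin_comb env (vexpr_coef e).
Proof.
  induction e as [n| |a IHa b IHb|c a IHa|a IHa]; simpl.
  - symmetry; apply lin_comb_var.
  - symmetry; apply lin_comb_zero.
  - rewrite IHa, IHb; symmetry; apply lin_comb_plus.
  - rewrite IHa; symmetry; apply lin_comb_scal.
  - rewrite IHa, <- (scal_opp_one (lin_comb env (vexpr_coef a))).
    rewrite <- (lin_comb_scal env (opp one)). apply lin_comb_ext. intros i.
    change (Cmult (Copp (RtoC 1)) (vexpr_coef a i) = Copp (vexpr_coef a i)). ring.
Qed.

Lemma vexpr_eq {X : ModuleSpace C_Ring} (env : list X) (e1 e2 : vexpr) :
  lin_comb env (vexpr_coef e1) = lin_comb env (vexpr_coef e2) ->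
  vexpr_den env e1 = vexpr_den env e2.
Proof. now rewrite !vexpr_den_coef. Qed.

Ltac vlookup x env :=
  lazymatch env with
  | x :: _ => constr:(O)
  | _ :: ?l => let n := vlookup x l in constr:(S n)
  end.
Ltac vmember x env :=
  lazymatch env with
  | nil => constr:(false)
  | x :: _ => constr:(true)
  | _ :: ?l => vmember x l
  end.
Ltac vcollect env e :=
  lazymatch e with
  | @plus _ ?a ?b => let env := vcollect env a in vcollect env b
  | @minus _ ?a ?b => let env := vcollect env a in vcollect env b
  | @scal _ _ _ ?a => vcollect env a
  | @opp _ ?a => vcollect env a
  | @zero _ => env
  | ?x => let b := vmember x env in
          lazymatch b with true => env | false => constr:(x :: env) end
  end.
Ltac vreify env e :=
  lazymatch e with
  | @plus _ ?a ?b => let a := vreify env a in let b := vreify env b in constr:(VPlus a b)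
  | @minus _ ?a ?b => let a := vreify env a in let b := vreify env b in constr:(VPlus a (VOpp b))
  | @scal _ _ ?c ?a => let a := vreify env a in constr:(VScal c a)
  | @opp _ ?a => let a := vreify env a in constr:(VOpp a)
  | @zero _ => constr:(VZero)
  | ?x => let n := vlookup x env in constr:(VVar n)
  end.

(* Proves an equation between linear combinations by comparing the complex coefficient of each
   vector. *)
Ltac module_eq :=
  lazymatch goal with
  | |- @eq ?X ?a ?b =>
    let env := vcollect (@nil X) a in
    let env := vcollect env b in
    let e1 := vreify env a in
    let e2 := vreify env b in
    refine (vexpr_eq env e1 e2 _);
    simpl vexpr_coef; simpl lin_comb;
    repeat (apply f_equal2; [ apply f_equal2; [ cbn; ring | reflexivity ] | ]); reflexivity
  end.

(** * Homogeneity of the norm and the Hahn-Banach theorem *)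

(** [norm_scal] is an inequality; applied to [Cinv l] and [scal l x] it gives the reverse one. *)
Lemma norm_scal_C {X : NormedModule C_AbsRing} (l : C) (x : X) :
  norm (scal l x) = Cmod l * norm x.
Proof.
  apply Rle_antisym.
  { exact (norm_scal l x). }
  destruct (Req_dec (Cmod l) 0) as [H0|H0].
  { rewrite H0, Rmult_0_l. apply norm_ge_0. }
  assert (Hl : l <> RtoC 0) by (intros E; apply H0; rewrite E; apply Cmod_0).
  assert (Hx : x = scal (Cinv l) (scal l x)).
  { replace (scal (Cinv l) (scal l x)) with (scal (Cmult (Cinv l) l) x) by module_eq.
    rewrite Cinv_l by exact Hl. symmetry; exact (scal_one x). }
  assert (H : norm x <= / Cmod l * norm (scal l x)).
  { rewrite Hx at 1. rewrite <- Cmod_inv by exact Hl. exact (norm_scal (Cinv l) (scal l x)). }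
  assert (Hp : 0 < Cmod l) by (apply Cmod_gt_0; exact Hl).
  apply Rmult_le_compat_l with (r := Cmod l) in H; [|lra].
  rewrite <- Rmult_assoc, Rinv_r, Rmult_1_l in H by lra. exact H.
Qed.

Lemma norm_scal_RtoC {X : NormedModule C_AbsRing} (s : R) (x : X) :
  norm (scal (RtoC s) x) = Rabs s * norm x.
Proof. now rewrite norm_scal_C, Cmod_R. Qed.

Lemma norm_triangle_eq {X : NormedModule C_AbsRing} (a b c : X) :
  a = plus b c -> norm a <= norm b + norm c.
Proof. intros ->. exact (norm_triangle b c). Qed.

(* A graph, i.e. a set of pairs (w, a), of a real-linear functional dominated by the norm.
   Instead of asking for the pair (y, norm y) we ask for stability under translation along it, so
   that the empty graph qualifies and Zorn's lemma needs no separate treatment of the empty chain. *)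
Definition dominated_graph {X : NormedModule C_AbsRing} (y : X) (G : X * R -> Prop) : Prop :=
  (forall w a w' a' s t, G (w, a) -> G (w', a') ->
     G (plus (scal (RtoC s) w) (scal (RtoC t) w'), s * a + t * a')) /\
  (forall w a, G (w, a) -> a <= norm w) /\
  (forall w a s, G (w, a) -> G (plus w (scal (RtoC s) y), a + s * norm y)).

(** The value [c] at [z] must satisfy [a - norm (w - z) <= c <= norm (v + z) - b] for all [(w, a)]
    and [(v, b)] in [G]. The two sides are compatible because [a + b <= norm (w + v)], so the
    supremum of the left sides serves. Dividing by [|s|] reduces domination at [w + s z] to one of
    these bounds, according to the sign of [s]. *)
Lemma dominated_graph_extend {X : NormedModule C_AbsRing} (y z : X) (G : X * R -> Prop) :
  dominated_graph y G -> G (zero, 0) ->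
  exists c, dominated_graph y
    (fun p => exists w a s, G (w, a) /\ p = (plus w (scal (RtoC s) z), a + s * c)).
Proof.
  intros (Hlin & Hdom & Hy) H0.
  destruct (completeness (fun b => exists w a, G (w, a) /\ b = a - norm (minus w z)))
    as [c [Hub Hlub]].
  { exists (norm z). intros b (w & a & Hw & ->).
    pose proof (Hdom _ _ Hw).
    pose proof (norm_triangle_eq w (minus w z) z ltac:(module_eq)). lra. }
  { exists (0 - norm (minus zero z)). now exists zero, 0. }
  exists c. split; [|split].
  - intros w1 a1 w2 a2 s t (v & a & r & Hv & E1) (v' & a' & r' & Hv' & E2).
    injection E1 as -> ->. injection E2 as -> ->.
    exists (plus (scal (RtoC s) v) (scal (RtoC t) v')), (s * a + t * a'), (s * r + t * r').
    split; [now apply Hlin|]. f_equal; [|ring].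
    rewrite RtoC_plus, !RtoC_mult. module_eq.
  - intros w1 a1 (w & a & s & Hw & E). injection E as -> ->.
    assert (Hs : forall k, G (scal (RtoC k) w, k * a)).
    { intros k. refine (eq_ind _ G (Hlin _ _ _ _ k 0 Hw Hw) _ _).
      f_equal; [module_eq|ring]. }
    destruct (Rtotal_order s 0) as [Hneg|[->|Hpos]].
    + assert (Hi : 0 < / - s) by (apply Rinv_0_lt_compat; lra).
      assert (H : / - s * a - norm (minus (scal (RtoC (/ - s)) w) z) <= c).
      { apply Hub. now exists (scal (RtoC (/ - s)) w), (/ - s * a). }
      apply Rmult_le_compat_l with (r := - s) in H; [|lra].
      rewrite Rmult_minus_distr_l, <- Rmult_assoc, Rinv_r, Rmult_1_l in H by lra.
      replace (- s * norm (minus (scal (RtoC (/ - s)) w) z))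
        with (norm (plus w (scal (RtoC s) z))) in H.
      { lra. }
      rewrite <- (Rabs_right (- s)) at 1 by lra. rewrite <- norm_scal_RtoC.
      f_equal.
      transitivity (plus (scal (RtoC (- s * / - s)) w) (scal (RtoC s) z)).
      { rewrite Rinv_r by lra. module_eq. }
      rewrite RtoC_mult, RtoC_opp. module_eq.
    + replace (plus w (scal (RtoC 0) z)) with w by module_eq.
      pose proof (Hdom _ _ Hw). lra.
    + assert (Hi : 0 < / s) by (apply Rinv_0_lt_compat; lra).
      assert (H : c <= norm (plus (scal (RtoC (/ s)) w) z) - / s * a).
      { apply Hlub. intros b (v & b' & Hv & ->).
        pose proof (Hdom _ _ (Hlin _ _ _ _ 1 1 Hv (Hs (/ s)))) as H.
        pose proof (norm_triangle_eq
          (plus (scal (RtoC 1) v) (scal (RtoC 1) (scal (RtoC (/ s)) w)))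
          (minus v z) (plus (scal (RtoC (/ s)) w) z) ltac:(module_eq)).
        lra. }
      apply Rmult_le_compat_l with (r := s) in H; [|lra].
      rewrite Rmult_minus_distr_l, <- Rmult_assoc, Rinv_r, Rmult_1_l in H by lra.
      replace (s * norm (plus (scal (RtoC (/ s)) w) z))
        with (norm (plus w (scal (RtoC s) z))) in H.
      { lra. }
      rewrite <- (Rabs_right s) at 2 by lra. rewrite <- norm_scal_RtoC.
      f_equal.
      transitivity (plus (scal (RtoC (s * / s)) w) (scal (RtoC s) z)).
      { rewrite Rinv_r by lra. module_eq. }
      rewrite RtoC_mult. module_eq.
  - intros w1 a1 t (w & a & s & Hw & E). injection E as -> ->.
    exists (plus w (scal (RtoC t) y)), (a + t * norm y), s. split; [now apply Hy|].
    f_equal; [module_eq|ring].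
Qed.

Lemma hahn_banach_real {X : NormedModule C_AbsRing} (y : X) :
  exists u : X -> R,
    (forall a b, u (plus a b) = u a + u b) /\
    (forall s a, u (scal (RtoC s) a) = s * u a) /\
    (forall a, u a <= norm a) /\ u y = norm y.
Proof.
  destruct (classical_sets.Zorn_bigcup (T := X * R) (P := dominated_graph y)) as [G [HG Hmax]].
  { intros F HF Htot. split; [|split].
    - intros w a w' a' s t [A HA Hw] [B HB Hw'].
      destruct (Htot A B HA HB) as [HAB|HBA].
      + exists B; [exact HB|]. apply (HF B HB); [now apply HAB|exact Hw'].
      + exists A; [exact HA|]. apply (HF A HA); [exact Hw|now apply HBA].
    - intros w a [A HA Hw]. now apply (HF A HA).
    - intros w a s [A HA Hw]. exists A; [exact HA|]. now apply (HF A HA). }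
  (* Maximality in usable form: a dominated graph that contains [G] is contained in [G]. *)
  assert (Hext : forall B : X * R -> Prop,
            (forall p, G p -> B p) -> dominated_graph y B -> forall p, B p -> G p).
  { intros B HGB HB p Hp. destruct (classic (G p)) as [HGp|HGp]; [exact HGp|].
    exfalso. apply (Hmax B); [|exact HB]. split; [exact HGB|].
    intros HBG. apply HGp, HBG, Hp. }
  (* If [G] were empty, the graph on the real line through [y] would be a proper extension of it. *)
  assert (Hne : exists p, G p).
  { destruct (classic (exists p, G p)) as [H|H]; [exact H|].
    exists (zero, 0).
    apply (Hext (fun p => exists s, p = (scal (RtoC s) y, s * norm y))).
    - intros p Hp. exfalso; apply H. now exists p.
    - split; [|split].
      + intros w a w' a' s t [r E] [r' E']. injection E as -> ->. injection E' as -> ->.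
        exists (s * r + t * r'). f_equal; [|ring].
        rewrite RtoC_plus, !RtoC_mult. module_eq.
      + intros w a [r E]. injection E as -> ->. rewrite norm_scal_RtoC.
        apply Rmult_le_compat_r; [apply norm_ge_0|apply Rle_abs].
      + intros w a s [r E]. injection E as -> ->. exists (r + s).
        rewrite RtoC_plus. f_equal; [module_eq|ring].
    - exists 0. rewrite Rmult_0_l. f_equal. module_eq. }
  destruct HG as (Hlin & Hdom & Hy).
  assert (H0 : G (zero, 0)).
  { destruct Hne as [[w a] Hw]. refine (eq_ind _ G (Hlin _ _ _ _ 0 0 Hw Hw) _ _).
    f_equal; [module_eq|ring]. }
  assert (Htotal : forall z, exists a, G (z, a)).
  { intros z. destruct (dominated_graph_extend y z G) as [c Hc];
      [now split|exact H0|].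
    exists c. apply (Hext _) with (2 := Hc).
    - intros [w a] Hw. exists w, a, 0. split; [exact Hw|].
      f_equal; [module_eq|ring].
    - exists zero, 0, 1. split; [exact H0|]. f_equal; [module_eq|ring]. }
  (* Domination forces single-valuedness: the difference of two values at [z] is a value at [zero],
     hence at most [norm zero = 0]. *)
  assert (Hfun : forall z a b, G (z, a) -> G (z, b) -> a = b).
  { assert (Hle : forall z a b, G (z, a) -> G (z, b) -> a <= b).
    { intros z a b Ha Hb.
      assert (H : G (zero, a - b)).
      { refine (eq_ind _ G (Hlin _ _ _ _ 1 (-1) Ha Hb) _ _).
        f_equal; [module_eq|ring]. }
      apply Hdom in H. rewrite norm_zero in H. lra. }
    intros z a b Ha Hb. apply Rle_antisym; eapply Hle; eassumption. }
  exists (fun z => epsilon (inhabits 0) (fun a => G (z, a))).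
  assert (Hu : forall z, G (z, epsilon (inhabits 0) (fun a => G (z, a)))).
  { intros z. apply epsilon_spec, Htotal. }
  split; [|split; [|split]].
  - intros a b. apply (Hfun (plus a b)); [apply Hu|].
    refine (eq_ind _ G (Hlin _ _ _ _ 1 1 (Hu a) (Hu b)) _ _).
    f_equal; [module_eq|ring].
  - intros s a. apply (Hfun (scal (RtoC s) a)); [apply Hu|].
    refine (eq_ind _ G (Hlin _ _ _ _ s 0 (Hu a) (Hu a)) _ _).
    f_equal; [module_eq|ring].
  - intros a. apply Hdom, Hu.
  - apply (Hfun y); [apply Hu|]. 
    (* Translating [(zero, 0)] once along [(y, norm y)] puts [(y, norm y)] into the graph. *)
    refine (eq_ind _ G (Hy _ _ 1 H0) _ _). f_equal; [module_eq|ring].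
Qed.

(* Bohnenblust-Sobczyk: [f z = u z - i u (i z)], and [|f z|] is the value of [u] at a rotated
   point. *)
Lemma hahn_banach_norming {X : NormedModule C_AbsRing} (y : X) :
  exists f : X -> C_NormedModule,
    is_linear f /\ (forall z, Cmod (f z) <= norm z) /\ Re (f y) = norm y.
Proof.
  destruct (hahn_banach_real y) as (u & Hadd & Hscal & Hdom & Hy).
  set (f := fun z : X => (u z, - u (scal Ci z)) : C).
  assert (Hplus : forall a b, f (plus a b) = Cplus (f a) (f b)).
  { intros a b. unfold f. rewrite Hadd.
    replace (scal Ci (plus a b)) with (plus (scal Ci a) (scal Ci b)) by module_eq.
    rewrite Hadd. apply injective_projections; simpl; ring. }
  assert (Hreal : forall s a, f (scal (RtoC s) a) = Cmult (RtoC s) (f a)).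
  { intros s a. unfold f.
    replace (scal Ci (scal (RtoC s) a)) with (scal (RtoC s) (scal Ci a)) by module_eq.
    rewrite !Hscal. apply injective_projections; simpl; ring. }
  assert (HI : forall a, f (scal Ci a) = Cmult Ci (f a)).
  { intros a. unfold f.
    replace (scal Ci (scal Ci a)) with (scal (RtoC (-1)) a).
    - rewrite Hscal. apply injective_projections; simpl; ring.
    - replace (scal Ci (scal Ci a)) with (scal (Cmult Ci Ci) a) by module_eq.
      f_equal. apply injective_projections; simpl; ring. }
  assert (Hlin : forall k a, f (scal k a) = Cmult k (f a)).
  { intros k a.
    assert (Ek : k = Cplus (RtoC (Re k)) (Cmult (RtoC (Im k)) Ci))
      by (unfold Re, Im; apply injective_projections; simpl; ring).
    transitivity (f (plus (scal (RtoC (Re k)) a) (scal (RtoC (Im k)) (scal Ci a)))).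
    { apply (f_equal f). transitivity (scal (Cplus (RtoC (Re k)) (Cmult (RtoC (Im k)) Ci)) a).
      - now rewrite <- Ek.
      - module_eq. }
    rewrite Hplus, !Hreal, HI. rewrite Ek at 3. ring. }
  assert (Hbound : forall z, Cmod (f z) <= norm z).
  { intros z. destruct (Req_dec (Cmod (f z)) 0) as [E|E].
    { rewrite E. apply norm_ge_0. }
    set (c := Cdiv (Cconj (f z)) (RtoC (Cmod (f z)))).
    assert (Hc : Cmod c = 1).
    { unfold c. rewrite Cmod_div, Cmod_conj, Cmod_R, Rabs_right.
      - now apply Rinv_r.
      - apply Rle_ge, Cmod_ge_0.
      - intros H; apply E. now injection H. }
    assert (Hr : f (scal c z) = RtoC (Cmod (f z))).
    { rewrite Hlin. unfold c.
      assert (H2 : Cmult (Cconj (f z)) (f z) = RtoC (Cmod (f z) * Cmod (f z))).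
      { rewrite Cmult_comm, <- Cmod2_conj. f_equal. simpl; ring. }
      replace (Cmult (Cdiv (Cconj (f z)) (RtoC (Cmod (f z)))) (f z))
        with (Cmult (Cmult (Cconj (f z)) (f z)) (Cinv (RtoC (Cmod (f z)))))
        by (unfold Cdiv; ring).
      rewrite H2, RtoC_mult. rewrite <- Cmult_assoc, Cinv_r; [apply Cmult_1_r|].
      intros H; apply E. now injection H. }
    assert (Hu : u (scal c z) = Cmod (f z)) by exact (f_equal Re Hr).
    rewrite <- Hu. rewrite <- (Rmult_1_l (norm z)), <- Hc, <- norm_scal_C. apply Hdom. }
  exists f. split; [|split].
  - split.
    + exact Hplus.
    + exact Hlin.
    + exists 1. split; [lra|]. intros x. rewrite Rmult_1_l. apply Hbound.
  - exact Hbound.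
  - exact Hy.
Qed.

(* [norm_scal_C] again: rewriting does not see through the coercion from complete modules. *)
Lemma norm_scal_complete {X : CompleteNormedModule C_AbsRing} (l : C) (x : X) :
  norm (scal l x) = Cmod l * norm x.
Proof. exact (norm_scal_C l x). Qed.

(** * Powers of operators and the resolvent identity *)

Lemma op_pow_S {X : CompleteNormedModule C_AbsRing} (A : X -> X) (n : nat) (x : X) :
  op_pow A (S n) x = A (op_pow A n x).
Proof. reflexivity. Qed.

Lemma op_pow_S_r {X : CompleteNormedModule C_AbsRing} (A : X -> X) (n : nat) (x : X) :
  op_pow A (S n) x = op_pow A n (A x).
Proof.
  induction n as [|n IH]; [reflexivity|].
  rewrite op_pow_S, IH. reflexivity.
Qed.

(** The decomposition of [a] is a hypothesis so that [module_eq] can supply it; subtraction is the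
    case [k = -1]. *)
Lemma linear_minus_eq {X : CompleteNormedModule C_AbsRing} (A : X -> X) (a b c : X) (k : C) :
  is_linear A -> a = plus b (scal k c) -> A a = plus (A b) (scal k (A c)).
Proof.
  intros HA ->. rewrite (linear_plus _ HA). f_equal. apply (linear_scal _ HA).
Qed.

(* If [R - R0 = - h R R0] then [R^k = R0^k - k h R0^(k+1) + O(h^2)]. *)
Lemma op_pow_taylor {X : CompleteNormedModule C_AbsRing} (B : R) (k : nat) :
  0 <= B ->
  exists K, 0 <= K /\
    forall (S S0 : X -> X) (h : C),
      is_linear S ->
      (forall z, norm (S z) <= B * norm z) ->
      (forall z, norm (S0 z) <= B * norm z) ->
      (forall z, S z = minus (S0 z) (scal h (S (S0 z)))) ->
      forall z,
        norm (minus (op_pow S k z)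
                (minus (op_pow S0 k z) (scal (Cmult (RtoC (INR k)) h) (op_pow S0 (k + 1) z))))
        <= K * (Cmod h) ^ 2 * norm z.
Proof.
  intros HB. induction k as [|k [K [HK IH]]].
  - exists 0. split; [lra|]. intros S S0 h _ _ _ _ z.
    rewrite Rmult_0_l, Rmult_0_l.
    replace (minus _ _) with (@zero (NormedModule.AbelianMonoid C_AbsRing X)).
    + rewrite norm_zero. lra.
    + simpl INR. simpl. change (op_pow S 0 z) with z. change (op_pow S0 0 z) with z. module_eq.
  (* The remainders satisfy [D_(k+1) = (k+1) h^2 S S0^(k+2) z + S D_k], which gives this recursion.
     The constant depends on [B] and [k] only, as it must, since [S] varies with [h]. *)
  - exists (INR (k + 1) * (B * B ^ (k + 2)) + B * K).
    assert (Hk : 0 <= INR (k + 1)) by apply pos_INR.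
    split.
    { apply Rplus_le_le_0_compat; apply Rmult_le_pos; try easy.
      apply Rmult_le_pos; [easy|]. now apply pow_le. }
    intros S S0 h HS HSB HS0B Hid z.
    assert (Hpow : forall j, norm (op_pow S0 j z) <= B ^ j * norm z).
    { induction j as [|j IHj].
      - simpl. change (op_pow S0 0 z) with z. lra.
      - rewrite op_pow_S. eapply Rle_trans; [apply HS0B|]. simpl pow.
        rewrite Rmult_assoc. now apply Rmult_le_compat_l. }
    set (D := minus (op_pow S k z)
                (minus (op_pow S0 k z) (scal (Cmult (RtoC (INR k)) h) (op_pow S0 (k + 1) z)))).
    assert (HD : norm D <= K * Cmod h ^ 2 * norm z) by (apply IH; assumption).
    set (w0 := op_pow S0 k z) in *.
    assert (E1 : op_pow S0 (k + 1) z = S0 w0) by (rewrite Nat.add_1_r; reflexivity).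
    assert (E2 : op_pow S0 (Datatypes.S k + 1) z = S0 (S0 w0)).
    { rewrite Nat.add_1_r. reflexivity. }
    assert (E3 : op_pow S0 (k + 2) z = S0 (S0 w0)).
    { replace (k + 2)%nat with (Datatypes.S (Datatypes.S k)) by lia. reflexivity. }
    assert (Hk1 : RtoC (INR (Datatypes.S k)) = Cplus (RtoC (INR k)) (RtoC 1)).
    { rewrite S_INR. apply RtoC_plus. }
    assert (HSk : S (op_pow S k z)
      = plus (S (plus w0 (scal (Copp (Cmult (RtoC (INR k)) h)) (S0 w0))))
             (scal (RtoC 1) (S D))).
    { apply linear_minus_eq; [exact HS|]. unfold D. rewrite E1. module_eq. }
    rewrite (linear_minus_eq S _ w0 (S0 w0) (Copp (Cmult (RtoC (INR k)) h)) HS eq_refl) in HSk.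
    assert (E : minus (op_pow S (Datatypes.S k) z)
        (minus (op_pow S0 (Datatypes.S k) z)
           (scal (Cmult (RtoC (INR (Datatypes.S k))) h) (op_pow S0 (Datatypes.S k + 1) z)))
      = plus (scal (Cmult (RtoC (INR (k + 1))) (Cmult h h)) (S (op_pow S0 (k + 2) z))) (S D)).
    { rewrite !op_pow_S, HSk, E2, E3. fold w0. rewrite (Hid w0), (Hid (S0 w0)).
      rewrite Nat.add_1_r, Hk1. module_eq. }
    eapply Rle_trans; [apply (norm_triangle_eq _ _ _ E)|].
    rewrite norm_scal_complete, !Cmod_mult, Cmod_R, Rabs_right by lra.
    rewrite Rmult_plus_distr_r, Rmult_plus_distr_r. apply Rplus_le_compat.
    + replace (INR (k + 1) * (B * B ^ (k + 2)) * Cmod h ^ 2 * norm z)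
        with (INR (k + 1) * (Cmod h * Cmod h) * (B * (B ^ (k + 2) * norm z))) by ring.
      apply Rmult_le_compat_l.
      { apply Rmult_le_pos; [lra|]. apply Rmult_le_pos; apply Cmod_ge_0. }
      eapply Rle_trans; [apply HSB|]. now apply Rmult_le_compat_l.
    + eapply Rle_trans; [apply HSB|].
      replace (B * K * Cmod h ^ 2 * norm z) with (B * (K * Cmod h ^ 2 * norm z)) by ring.
      now apply Rmult_le_compat_l.
Qed.

Lemma bounded_inverse_linear {X : CompleteNormedModule C_AbsRing} (A S : X -> X) :
  is_bounded_inverse A S -> is_linear S.
Proof. now intros [H _]. Qed.

(** Apply [Rl] to [(l - T) Rm z = z + (l - m) Rm z]. The form is the one that [op_pow_taylor] asks
    for, with [h = l - m]. *)
Lemma resolvent_identity {X : CompleteNormedModule C_AbsRing} (T : X -> X) (l m : C)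
    (Rl Rm : X -> X) :
  is_bounded_inverse (shifted l T) Rl -> is_bounded_inverse (shifted m T) Rm ->
  forall z, Rl z = minus (Rm z) (scal (Cminus l m) (Rl (Rm z))).
Proof.
  intros (HRl & Hl & _) (_ & _ & Hm) z.
  assert (E : shifted l T (Rm z) = plus z (scal (Cminus l m) (Rm z))).
  { rewrite <- (Hm z) at 2. unfold shifted. module_eq. }
  pose proof (linear_minus_eq Rl _ _ _ _ HRl E) as H. rewrite Hl in H.
  rewrite H at 1. module_eq.
Qed.

(** By the resolvent identity with the roles exchanged, [norm (Rl z) <= M * norm z + norm (Rl z) /
    2], and the last term is absorbed. This gives [op_pow_taylor] a bound that is uniform near a
    point. *)
Lemma resolvent_bounded_near {X : CompleteNormedModule C_AbsRing} (T : X -> X) (l m : C)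
    (Rl Rm : X -> X) (M : R) :
  is_bounded_inverse (shifted l T) Rl -> is_bounded_inverse (shifted m T) Rm ->
  (forall z, norm (Rm z) <= M * norm z) -> 2 * (M * Cmod (Cminus l m)) <= 1 ->
  forall z, norm (Rl z) <= 2 * M * norm z.
Proof.
  intros Hl Hm HM Hsmall z.
  assert (E : Rl z = plus (Rm z) (scal (Cminus m l) (Rm (Rl z)))).
  { rewrite (resolvent_identity T m l Rm Rl Hm Hl z). module_eq. }
  apply (norm_triangle_eq (X := X)) in E. rewrite norm_scal_complete in E.
  replace (Cmod (Cminus m l)) with (Cmod (Cminus l m)) in E
    by (rewrite <- Cmod_opp; f_equal; ring).
  pose proof (HM z) as H1. pose proof (HM (Rl z)) as H2.
  apply Rmult_le_compat_l with (r := Cmod (Cminus l m)) in H2; [|apply Cmod_ge_0].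
  pose proof (norm_ge_0 (Rl z)) as H3.
  apply Rmult_le_compat_r with (r := norm (Rl z)) in Hsmall; [|exact H3].
  lra.
Qed.

(** * Complex derivatives and their restriction to circles and rays *)

(** [C] is taken as a normed module over itself, the structure in which the product rule
    [is_derive_mult] applies. *)
Definition is_C_derivative (G : C -> C) (z d : C) : Prop :=
  is_derive (K := C_AbsRing) (V := AbsRing_NormedModule C_AbsRing) G z d.

Lemma is_C_derivative_eps (G : C -> C) (z d : C) :
  is_C_derivative G z d <->
  (forall eps : posreal, exists delta : posreal, forall w, Cmod (Cminus w z) < delta ->
     Cmod (Cminus (Cminus (G w) (G z)) (Cmult (Cminus w z) d)) <= eps * Cmod (Cminus w z)).
Proof.
  split.
  - intros [_ H] eps.
    destruct (H z (fun P HP => HP) eps) as [delta Hd].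
    exists delta. intros w Hw. exact (Hd w Hw).
  - intros H. split.
    + exact (is_linear_scal_l (K := C_AbsRing) (V := AbsRing_NormedModule C_AbsRing) d).
    + intros x Hx.
      apply (is_filter_lim_locally_unique (V := AbsRing_NormedModule C_AbsRing) z x) in Hx.
      subst x. intros eps. destruct (H eps) as [delta Hd].
      exists delta. intros w Hw. exact (Hd w Hw).
Qed.

Lemma is_C_derivative_mult (F G : C -> C) (z a b : C) :
  is_C_derivative F z a -> is_C_derivative G z b ->
  is_C_derivative (fun w => Cmult (F w) (G w)) z (Cplus (Cmult a (G z)) (Cmult (F z) b)).
Proof.
  intros HF HG. exact (is_derive_mult (K := C_AbsRing) F G z a b HF HG Cmult_comm).
Qed.

Lemma is_C_derivative_const (c z : C) : is_C_derivative (fun _ => c) z (RtoC 0).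
Proof. exact (is_derive_const (K := C_AbsRing) (V := AbsRing_NormedModule C_AbsRing) c z). Qed.

Lemma is_C_derivative_scal (c : C) (G : C -> C) (z d : C) :
  is_C_derivative G z d -> is_C_derivative (fun w => Cmult c (G w)) z (Cmult c d).
Proof.
  intros H.
  pose proof (is_C_derivative_mult _ _ _ _ _ (is_C_derivative_const c z) H) as H'.
  now rewrite Cmult_0_l, Cplus_0_l in H'.
Qed.

Lemma is_C_derivative_id (z : C) : is_C_derivative (fun w => w) z (RtoC 1).
Proof. exact (is_derive_id (K := C_AbsRing) z). Qed.

Lemma is_C_derivative_pow (n : nat) (z : C) :
  is_C_derivative (fun w => Cpow w n) z (Cmult (RtoC (INR n)) (Cpow z (pred n))).
Proof.
  induction n as [|n IH].
  - replace (Cmult _ _) with (RtoC 0).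
    + exact (is_C_derivative_const (RtoC 1) z).
    + simpl. ring.
  - pose proof (is_C_derivative_mult _ _ _ _ _ (is_C_derivative_id z) IH) as H.
    replace (Cmult (RtoC (INR (S n))) _)
      with (Cplus (Cmult (RtoC 1) (Cpow z n)) (Cmult z (Cmult (RtoC (INR n)) (Cpow z (pred n))))).
    + exact H.
    + rewrite S_INR, RtoC_plus. destruct n as [|n]; [simpl; ring|].
      simpl pred. rewrite (Cpow_S z n). ring.
Qed.

Lemma Re_le_Cmod (z : C) : Rabs (Re z) <= Cmod z.
Proof. eapply Rle_trans; [apply Rmax_l|apply Rmax_Cmod]. Qed.

(** Passes to the real plane, where curves and the chain rule live. The product norm there equals
    the modulus ([Cmod_norm]), so the epsilon estimate carries over with the same [delta]. *)
Lemma filterdiff_Re (G : C -> C) (z d : C) :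
  is_C_derivative G z d ->
  filterdiff (K := R_AbsRing) (U := prod_NormedModule R_AbsRing R_NormedModule R_NormedModule)
    (V := R_NormedModule) (fun w => Re (G w)) (locally z) (fun h => Re (Cmult d h)).
Proof.
  intros H. pose proof (proj1 (is_C_derivative_eps G z d) H) as He. clear H.
  split.
  - split.
    + intros x y. unfold Re. simpl. unfold plus; simpl. ring.
    + intros k x. unfold Re. simpl. unfold scal; simpl. unfold mult; simpl. ring.
    + exists (Cmod d + 1). split; [pose proof (Cmod_ge_0 d); lra|]. intros x.
      eapply Rle_trans; [apply Re_le_Cmod|]. rewrite Cmod_mult.
      rewrite <- (Cmod_norm x). pose proof (Cmod_ge_0 x). lra.
  - intros x Hx.
    apply (is_filter_lim_locally_unique
             (V := prod_NormedModule R_AbsRing R_NormedModule R_NormedModule) z x) in Hx.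
    subst x. intros eps. destruct (He eps) as [delta Hd].
    apply locally_C. exists delta. intros w Hw.
    eapply Rle_trans;
      [|apply Req_le; exact (f_equal (Rmult eps) (Cmod_norm (Cminus w z)))].
    eapply Rle_trans; [|exact (Hd w Hw)].
    eapply Rle_trans; [|apply Re_le_Cmod]. apply Req_le.
    change (norm ?u) with (Rabs u). f_equal.
    unfold Re. simpl. unfold minus, plus, opp; simpl. ring.
Qed.

Lemma circle_point_eq (r t : R) : circle_point r t = (r * cos t, r * sin t).
Proof. unfold circle_point. apply injective_projections; simpl; ring. Qed.

Lemma Cmod_circle_point (r t : R) : 0 <= r -> Cmod (circle_point r t) = r.
Proof.
  intros Hr. unfold circle_point. rewrite Cmod_mult, Cmod_R, Rabs_right by lra.
  replace (Cmod (cos t, sin t)) with 1; [ring|].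
  unfold Cmod. simpl. rewrite !Rmult_1_r.
  pose proof (sin2_cos2 t) as H. unfold Rsqr in H.
  rewrite Rplus_comm, H. symmetry; apply sqrt_1.
Qed.

Lemma is_derive_Re_curve (G : C -> C) (a b : R -> R) (t da db : R) (d : C) :
  is_C_derivative G (a t, b t) d -> is_derive a t da -> is_derive b t db ->
  is_derive (fun s => Re (G (a s, b s))) t (Re (Cmult d (da, db))).
Proof.
  intros HG Ha Hb. apply filterdiff_Re in HG.
  pose proof (filterdiff_comp'_2 (K := R_AbsRing) (T := R_NormedModule) (U := R_NormedModule)
    (V := R_NormedModule) (W := R_NormedModule) a b (fun u v => Re (G (u, v))) t
    _ _ (fun u v => Re (Cmult d (u, v))) Ha Hb) as H.
  unfold is_derive. eapply filterdiff_ext_lin.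
  - apply H.
    apply (filterdiff_ext (fun w : R * R => Re (G w)));
      [intros [u v]; reflexivity|].
    eapply filterdiff_ext_lin; [exact HG|]. now intros [u v].
  - intros h. simpl. unfold scal; simpl. unfold mult; simpl. ring.
Qed.

Lemma is_derive_Re_angle (G : C -> C) (r t : R) (d : C) :
  is_C_derivative G (circle_point r t) d ->
  is_derive (fun s => Re (G (circle_point r s))) t (Re (Cmult d (Cmult Ci (circle_point r t)))).
Proof.
  intros H.
  apply (is_derive_ext (fun s => Re (G (r * cos s, r * sin s)))).
  { intros s. now rewrite circle_point_eq. }
  replace (Cmult Ci (circle_point r t)) with (- (r * sin t), r * cos t).
  - apply is_derive_Re_curve.
    + now rewrite <- circle_point_eq.
    + auto_derive; [exact I|ring].
    + auto_derive; [exact I|ring].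
  - rewrite circle_point_eq. apply injective_projections; simpl; ring.
Qed.

(** Compare [is_derive_Re_angle]: [r] times the radial derivative of [Re G] is the angular
    derivative of [Re (-i G)], the polar Cauchy-Riemann equation behind [moment_0_1]. *)
Lemma is_derive_Re_radius (G : C -> C) (r t : R) (d : C) :
  is_C_derivative G (circle_point r t) d ->
  is_derive (fun s => Re (G (circle_point s t))) r (Re (Cmult d (cos t, sin t))).
Proof.
  intros H.
  apply (is_derive_ext (fun s => Re (G (s * cos t, s * sin t)))).
  { intros s. now rewrite circle_point_eq. }
  apply is_derive_Re_curve.
  - now rewrite <- circle_point_eq.
  - auto_derive; [exact I|ring].
  - auto_derive; [exact I|ring].
Qed.

(** Joint continuity in radius and angle is what differentiation under the integral sign requires in
    [moment_0_1]. *)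
Lemma continuity_2d_Re_circle (G : C -> C) (r t : R) (d : C) :
  is_C_derivative G (circle_point r t) d ->
  continuity_2d_pt (fun u v => Re (G (circle_point u v))) r t.
Proof.
  intros H. apply continuity_2d_pt_filterlim.
  apply filterdiff_Re in H.
  assert (Hc : continuous (fun w : R * R => Re (G w)) (circle_point r t)).
  { apply (filterdiff_continuous (K := R_AbsRing)
      (U := prod_NormedModule R_AbsRing R_NormedModule R_NormedModule) (V := R_NormedModule)).
    eexists; exact H. }
  rewrite circle_point_eq in Hc.
  assert (Hx : forall p : R * R, continuous (fun z : R * R => fst z * cos (snd z)) p).
  { intros [u v]. apply (continuous_mult (K := R_AbsRing)); [apply continuous_fst|].
    apply (continuous_comp snd cos); [apply continuous_snd|apply continuous_cos]. }
  assert (Hy : forall p : R * R, continuous (fun z : R * R => fst z * sin (snd z)) p).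
  { intros [u v]. apply (continuous_mult (K := R_AbsRing)); [apply continuous_fst|].
    apply (continuous_comp snd sin); [apply continuous_snd|apply continuous_sin]. }
  rewrite circle_point_eq.
  apply (filterlim_ext (fun z : R * R => Re (G (fst z * cos (snd z), fst z * sin (snd z))))).
  { intros z. now rewrite circle_point_eq. }
  apply (continuous_comp_2 _ _ (fun u v => Re (G (u, v))) (r, t) (Hx (r, t)) (Hy (r, t))).
  apply (continuous_ext (fun w : R * R => Re (G w))); [now intros [u v]|exact Hc].
Qed.

Lemma continuous_Re_angle (G : C -> C) (r t : R) (d : C) :
  is_C_derivative G (circle_point r t) d ->
  continuous (fun s => Re (G (circle_point r s))) t.
Proof.
  intros H. apply (ex_derive_continuous (K := R_AbsRing) (V := R_NormedModule)).
  eexists. exact (is_derive_Re_angle G r t d H).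
Qed.

(** The imaginary part of [G] is the real part of [-i G], so the modulus is built from functions
    already known to be continuous. *)
Lemma continuous_Cmod_angle (G : C -> C) (r t : R) (d : C) :
  is_C_derivative G (circle_point r t) d ->
  continuous (fun s => Cmod (G (circle_point r s))) t.
Proof.
  intros H.
  pose proof (is_C_derivative_scal (Copp Ci) _ _ _ H) as H'.
  apply continuous_Re_angle in H. apply continuous_Re_angle in H'.
  apply (continuous_ext (fun s => sqrt (Re (G (circle_point r s)) * Re (G (circle_point r s))
    + Re (Cmult (Copp Ci) (G (circle_point r s))) * Re (Cmult (Copp Ci) (G (circle_point r s)))))).
  { intros s. unfold Cmod, Re, Ci, Cmult, Copp. simpl. f_equal. ring. }
  apply (continuous_comp _ sqrt); [|apply continuous_sqrt].
  apply (continuous_plus (V := R_NormedModule)); apply (continuous_mult (K := R_AbsRing));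
    assumption.
Qed.

(** * Derivatives of resolvent powers and the moments *)

(** Hides the [epsilon] in [resolvent]: the analysis relies only on the inverse property outside the
    closed disc. *)
Definition resolvent_family {X : CompleteNormedModule C_AbsRing} (T : X -> X) (Rs : C -> X -> X) :
  Prop := forall l, 1 < Cmod l -> is_bounded_inverse (shifted l T) (Rs l).

Lemma linear_functional_bound {X : CompleteNormedModule C_AbsRing} (f : X -> C_NormedModule) :
  is_linear f -> exists M, 0 < M /\ forall x, Cmod (f x) <= M * norm x.
Proof. intros Hf. exact (linear_norm _ Hf). Qed.

Lemma linear_functional_eq {X : CompleteNormedModule C_AbsRing} (f : X -> C_NormedModule)
    (a b c : X) (k : C) :
  is_linear f -> a = plus b (scal k c) -> f a = Cplus (f b) (Cmult k (f c)) :> C.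
Proof.
  intros Hf ->. rewrite (linear_plus _ Hf).
  exact (f_equal (Cplus (f b)) (linear_scal _ Hf k c)).
Qed.

Lemma resolvent_power_derivative {X : CompleteNormedModule C_AbsRing} (T : X -> X)
    (Rs : C -> X -> X) (f : X -> C_NormedModule) (k : nat) (x : X) (l : C) :
  resolvent_family T Rs -> is_linear f -> 1 < Cmod l ->
  is_C_derivative (fun w => f (op_pow (Rs w) k x)) l
    (Copp (Cmult (RtoC (INR k)) (f (op_pow (Rs l) (k + 1) x)))).
Proof.
  intros HR Hf Hl.
  pose proof (HR l Hl) as HRl.
  destruct (linear_norm _ (bounded_inverse_linear _ _ HRl)) as [M [HM0 HM]].
  destruct (linear_functional_bound f Hf) as [Mf [HMf0 HMf]].
  destruct (op_pow_taylor (X := X) (2 * M) k ltac:(lra)) as [K [HK0 HK]].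
  apply is_C_derivative_eps. intros eps.
  set (Q := Mf * (K * norm x) + 1).
  assert (Hn : 0 <= norm x) by apply norm_ge_0.
  assert (HKx : 0 <= Mf * (K * norm x)) by (repeat apply Rmult_le_pos; lra).
  assert (HQ : 0 < Q) by (unfold Q; lra).
  (* The three radii keep [w] outside the closed disc, bound [Rs w] by [2 * M], and make the
     quadratic Taylor remainder at most [eps * Cmod h]. *)
  assert (Hd : 0 < Rmin (Cmod l - 1) (Rmin (/ (2 * M)) (eps / Q))).
  { apply Rmin_glb_lt; [lra|]. apply Rmin_glb_lt.
    - apply Rinv_0_lt_compat; lra.
    - apply Rdiv_lt_0_compat; [apply cond_pos|exact HQ]. }
  exists (mkposreal _ Hd). simpl. intros w Hw.
  assert (H1 : Cmod (Cminus w l) < Cmod l - 1) by (eapply Rlt_le_trans; [exact Hw|apply Rmin_l]).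
  assert (H2 : Cmod (Cminus w l) < / (2 * M)).
  { eapply Rlt_le_trans; [exact Hw|]. eapply Rle_trans; [apply Rmin_r|apply Rmin_l]. }
  assert (H3 : Cmod (Cminus w l) < eps / Q).
  { eapply Rlt_le_trans; [exact Hw|]. eapply Rle_trans; [apply Rmin_r|apply Rmin_r]. }
  set (h := Cminus w l) in *.
  assert (Hw1 : 1 < Cmod w).
  { pose proof (Cmod_triangle w (Copp h)) as Ht. rewrite Cmod_opp in Ht.
    replace (Cplus w (Copp h)) with l in Ht by (unfold h; ring). lra. }
  pose proof (HR w Hw1) as HRw.
  assert (HB : forall z, norm (Rs w z) <= 2 * M * norm z).
  { apply (resolvent_bounded_near T w l (Rs w) (Rs l) M HRw HRl HM).
    fold h. apply Rmult_lt_compat_l with (r := 2 * M) in H2; [|lra].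
    rewrite Rinv_r in H2; lra. }
  assert (HB0 : forall z, norm (Rs l z) <= 2 * M * norm z).
  { intros z. eapply Rle_trans; [apply HM|]. apply Rmult_le_compat_r; [apply norm_ge_0|lra]. }
  pose proof (HK (Rs w) (Rs l) h (bounded_inverse_linear _ _ HRw) HB HB0
    (resolvent_identity T w l _ _ HRw HRl) x) as HT.
  set (a := op_pow (Rs w) k x) in *. set (b := op_pow (Rs l) k x) in *.
  set (c := op_pow (Rs l) (k + 1) x) in *.
  assert (E : Cminus (Cminus (f a) (f b)) (Cmult h (Copp (Cmult (RtoC (INR k)) (f c))))
    = f (minus a (minus b (scal (Cmult (RtoC (INR k)) h) c)))).
  { rewrite (linear_functional_eq f (minus a (minus b (scal (Cmult (RtoC (INR k)) h) c)))
      (minus a b) c (Cmult (RtoC (INR k)) h) Hf) by module_eq.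
    rewrite (linear_functional_eq f (minus a b) a b (RtoC (-1)) Hf) by module_eq.
    generalize (f a : C) (f b : C) (f c : C). intros u v s. ring. }
  rewrite E. eapply Rle_trans; [apply HMf|].
  apply Rmult_le_compat_l with (r := Mf) in HT; [|lra].
  eapply Rle_trans; [exact HT|].
  pose proof (Cmod_ge_0 h) as Hh.
  apply Rmult_lt_compat_l with (r := Q) in H3; [|exact HQ].
  replace (Q * (eps / Q)) with (pos eps) in H3 by (field; lra).
  replace (Mf * (K * Cmod h ^ 2 * norm x)) with (Mf * (K * norm x) * Cmod h * Cmod h) by ring.
  apply Rmult_le_compat_r; [exact Hh|].
  apply Rle_trans with (2 := Rlt_le _ _ H3). apply Rmult_le_compat_r; [exact Hh|].
  unfold Q; lra.
Qed.

Definition moment {X : CompleteNormedModule C_AbsRing} (Rs : C -> X -> X)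
    (f : X -> C_NormedModule) (N k : nat) (r : R) (x : X) : R :=
  RInt (fun t => Re (Cmult (Cpow (circle_point r t) N) (f (op_pow (Rs (circle_point r t)) k x))))
    0 (2 * PI).

Lemma two_PI_pos : 0 < 2 * PI.
Proof. pose proof PI_RGT_0. lra. Qed.

Lemma moment_integrand_derivative {X : CompleteNormedModule C_AbsRing} (T : X -> X)
    (Rs : C -> X -> X) (f : X -> C_NormedModule) (N k : nat) (x : X) (l : C) :
  resolvent_family T Rs -> is_linear f -> 1 < Cmod l ->
  is_C_derivative (fun w => Cmult (Cpow w N) (f (op_pow (Rs w) k x))) l
    (Cplus (Cmult (Cmult (RtoC (INR N)) (Cpow l (pred N))) (f (op_pow (Rs l) k x)))
       (Cmult (Cpow l N) (Copp (Cmult (RtoC (INR k)) (f (op_pow (Rs l) (k + 1) x)))))).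
Proof.
  intros HR Hf Hl. apply (is_C_derivative_mult (fun w => Cpow w N)).
  - apply is_C_derivative_pow.
  - now apply (resolvent_power_derivative T).
Qed.

Lemma Cmod_circle_gt_1 (r t : R) : 1 < r -> 1 < Cmod (circle_point r t).
Proof. intros Hr. rewrite Cmod_circle_point; lra. Qed.

Lemma continuous_moment_integrand {X : CompleteNormedModule C_AbsRing} (T : X -> X)
    (Rs : C -> X -> X) (f : X -> C_NormedModule) (N k : nat) (x : X) (r t : R) :
  resolvent_family T Rs -> is_linear f -> 1 < r ->
  continuous (fun t => Re (Cmult (Cpow (circle_point r t) N)
                             (f (op_pow (Rs (circle_point r t)) k x)))) t.
Proof.
  intros HR Hf Hr.
  apply (continuous_Re_angle (fun w => Cmult (Cpow w N) (f (op_pow (Rs w) k x))) r t _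
    (moment_integrand_derivative T Rs f N k x _ HR Hf (Cmod_circle_gt_1 r t Hr))).
Qed.

Lemma ex_RInt_moment {X : CompleteNormedModule C_AbsRing} (T : X -> X)
    (Rs : C -> X -> X) (f : X -> C_NormedModule) (N k : nat) (x : X) (r : R) :
  resolvent_family T Rs -> is_linear f -> 1 < r ->
  ex_RInt (fun t => Re (Cmult (Cpow (circle_point r t) N)
                          (f (op_pow (Rs (circle_point r t)) k x)))) 0 (2 * PI).
Proof.
  intros HR Hf Hr. apply (ex_RInt_continuous (V := R_CompleteNormedModule)). intros t _.
  now apply (continuous_moment_integrand T).
Qed.

(** * Integrals of derivatives over a circle *)

(** The primitive [Re (G (circle_point r t))] takes the same value at [0] and [2 * PI], because the
    circle closes up. *)
Lemma is_RInt_angle_derivative (G : C -> C) (d : C -> C) (r : R) :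
  (forall t, is_C_derivative G (circle_point r t) (d (circle_point r t))) ->
  (forall t, continuous
     (fun s => Re (Cmult (d (circle_point r s)) (Cmult Ci (circle_point r s)))) t) ->
  is_RInt (fun t => Re (Cmult (d (circle_point r t)) (Cmult Ci (circle_point r t))))
    0 (2 * PI) 0.
Proof.
  intros HG Hc.
  replace 0 with (minus (Re (G (circle_point r (2 * PI)))) (Re (G (circle_point r 0)))) at 2.
  - apply (is_RInt_derive (V := R_CompleteNormedModule) (fun s => Re (G (circle_point r s)))).
    + intros t _. now apply is_derive_Re_angle.
    + intros t _. apply Hc.
  - replace (circle_point r (2 * PI)) with (circle_point r 0).
    + exact (Rminus_diag_eq _ _ eq_refl).
    + unfold circle_point. rewrite cos_2PI, sin_2PI, cos_0, sin_0. reflexivity.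
Qed.

(** At [N = 0], where [pred] truncates, the factor [INR N] vanishes. *)
Lemma Cpow_pred_mult (N : nat) (w : C) :
  Cmult (Cmult (RtoC (INR N)) (Cpow w (pred N))) w = Cmult (RtoC (INR N)) (Cpow w N).
Proof. destruct N as [|N]; simpl pred; [simpl; ring|]. rewrite (Cpow_S w N). ring. Qed.

(* Integration by parts: [d (l^N R^k) = (N l^(N-1) R^k - k l^N R^(k+1)) dl]. *)
Lemma moment_by_parts {X : CompleteNormedModule C_AbsRing} (T : X -> X)
    (Rs : C -> X -> X) (f : X -> C_NormedModule) (N k : nat) (x : X) (r : R) :
  resolvent_family T Rs -> is_linear f -> 1 < r ->
  INR k * moment Rs f (S N) (k + 1) r x = INR N * moment Rs f N k r x.
Proof.
  intros HR Hf Hr.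
  set (g := fun N k t => Re (Cmult (Cpow (circle_point r t) N)
              (f (op_pow (Rs (circle_point r t)) k x)))).
  assert (Hg : forall N k, is_RInt (g N k) 0 (2 * PI) (moment Rs f N k r x)).
  { intros N' k'. apply (RInt_correct (V := R_CompleteNormedModule)).
    now apply (ex_RInt_moment T). }
  pose proof (is_RInt_minus (V := R_NormedModule) _ _ _ _ _ _
    (is_RInt_scal (V := R_NormedModule) _ _ _ (INR N) _ (Hg N k))
    (is_RInt_scal (V := R_NormedModule) _ _ _ (INR k) _ (Hg (S N) (k + 1)%nat))) as H1.
  (* The factor [-i] cancels the [i] of [dl = i l dt], so that the real part of the integrand is the
     one occurring in [moment]. *)
  set (d := fun w : C => Cmult (Copp Ci)
       (Cplus (Cmult (Cmult (RtoC (INR N)) (Cpow w (pred N))) (f (op_pow (Rs w) k x)))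
       (Cmult (Cpow w N) (Copp (Cmult (RtoC (INR k)) (f (op_pow (Rs w) (k + 1) x))))))).
  assert (Ed : forall t, Re (Cmult (d (circle_point r t)) (Cmult Ci (circle_point r t)))
    = INR N * g N k t - INR k * g (S N) (k + 1)%nat t).
  { intros t. unfold g, d. cbv beta.
    generalize (f (op_pow (Rs (circle_point r t)) k x) : C)
      (f (op_pow (Rs (circle_point r t)) (k + 1) x) : C).
    intros a b. generalize (circle_point r t). intros w.
    transitivity (Re (Cminus (Cmult (RtoC (INR N)) (Cmult (Cpow w N) a))
      (Cmult (RtoC (INR k)) (Cmult (Cpow w (S N)) b)))).
    - f_equal. rewrite (Cpow_S w N).
      transitivity (Cmult (Cmult Ci (Copp Ci)) (Cminus
        (Cmult (Cmult (Cmult (RtoC (INR N)) (Cpow w (pred N))) w) a)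
        (Cmult (RtoC (INR k)) (Cmult (Cmult w (Cpow w N)) b)))); [ring|].
      replace (Cmult Ci (Copp Ci)) with (RtoC 1)
        by (apply injective_projections; simpl; ring).
      rewrite Cpow_pred_mult. ring.
    - unfold Re. simpl. ring. }
  assert (H2 : is_RInt (fun t => Re (Cmult (d (circle_point r t)) (Cmult Ci (circle_point r t))))
    0 (2 * PI) 0).
  { apply (is_RInt_angle_derivative
      (fun w => Cmult (Copp Ci) (Cmult (Cpow w N) (f (op_pow (Rs w) k x)))) d).
    - intros t. exact (is_C_derivative_scal _ _ _ _
        (moment_integrand_derivative T Rs f N k x _ HR Hf (Cmod_circle_gt_1 r t Hr))).
    - intros t. apply (continuous_ext (fun t => INR N * g N k t - INR k * g (S N) (k + 1)%nat t)).
      { intros s. symmetry. apply Ed. }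
      apply (continuous_minus (V := R_NormedModule));
        apply (continuous_scal_r (V := R_NormedModule));
        now apply (continuous_moment_integrand T). }
  pose proof (is_RInt_unique (V := R_CompleteNormedModule) _ _ _ _ H1) as U1.
  pose proof (is_RInt_unique (V := R_CompleteNormedModule) _ _ _ _ H2) as U2.
  rewrite (RInt_ext _ _ 0 (2 * PI) (fun t _ => Ed t)) in U2.
  assert (U : 0 = INR N * moment Rs f N k r x - INR k * moment Rs f (S N) (k + 1) r x).
  { etransitivity; [symmetry; exact U2|exact U1]. }
  lra.
Qed.

(** [c l^(N+1) dt] has the primitive [-i c l^(N+1) / (N+1)]; the exponent [S N] keeps the
    denominator nonzero. *)
Lemma RInt_circle_pow (c : C) (N : nat) (r : R) :
  RInt (fun t => Re (Cmult (Cpow (circle_point r t) (S N)) c)) 0 (2 * PI) = 0.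
Proof.
  set (a := Cdiv (Copp Ci) (RtoC (INR (S N)))).
  assert (HN : RtoC (INR (S N)) <> RtoC 0).
  { intros E. apply (not_0_INR (S N)); [discriminate|]. now injection E. }
  set (d := fun w : C => Cmult (Cmult c a) (Cmult (RtoC (INR (S N))) (Cpow w N))).
  assert (Ed : forall w, Cmult (d w) (Cmult Ci w) = Cmult (Cpow w (S N)) c).
  { intros w. unfold d, a. rewrite (Cpow_S w N).
    transitivity (Cmult (Cmult Ci (Copp Ci)) (Cmult (Cmult w (Cpow w N)) c)); [now field|].
    replace (Cmult Ci (Copp Ci)) with (RtoC 1)
      by (apply injective_projections; simpl; ring). ring. }
  apply (is_RInt_unique (V := R_CompleteNormedModule)).
  apply (is_RInt_ext (fun t => Re (Cmult (d (circle_point r t)) (Cmult Ci (circle_point r t))))).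
  { intros t _. now rewrite Ed. }
  apply (is_RInt_angle_derivative (fun w => Cmult (Cmult c a) (Cpow w (S N)))).
  - intros t. exact (is_C_derivative_scal _ _ _ _ (is_C_derivative_pow (S N) _)).
  - intros t.
    apply (continuous_ext (fun s => Re (Cmult (Cpow (circle_point r s) (S N)) c))).
    { intros s. now rewrite Ed. }
    apply (continuous_Re_angle (fun w => Cmult (Cpow w (S N)) c) r t _
      (is_C_derivative_mult _ (fun _ => c) _ _ _ (is_C_derivative_pow _ _)
         (is_C_derivative_const _ _))).
Qed.

(** * Evaluation of the moments with one resolvent factor *)

Lemma moment_shift {X : CompleteNormedModule C_AbsRing} (T : X -> X)
    (Rs : C -> X -> X) (f : X -> C_NormedModule) (N : nat) (x : X) (r : R) :
  resolvent_family T Rs -> is_linear f -> 1 < r ->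
  moment Rs f (S N) 1 r x
  = RInt (fun t => Re (Cmult (Cpow (circle_point r t) N) (f x))) 0 (2 * PI)
    + moment Rs f N 1 r (T x).
Proof.
  intros HR Hf Hr. unfold moment.
  etransitivity; [|apply (RInt_plus (V := R_CompleteNormedModule))].
  - apply RInt_ext. intros t _.
    pose proof (HR _ (Cmod_circle_gt_1 r t Hr)) as (HRl & Hinv & _).
    generalize dependent (circle_point r t). intros w HRw Hinv.
    change (op_pow (Rs w) 1 x) with (Rs w x). change (op_pow (Rs w) 1 (T x)) with (Rs w (T x)).
    assert (E : f x = Cminus (Cmult w (f (Rs w x))) (f (Rs w (T x))) :> C).
    { rewrite <- (Hinv x) at 1. unfold shifted.
      rewrite (linear_minus_eq (Rs w) (minus (scal w x) (T x)) (scal w x) (T x) (RtoC (-1)) HRw) by module_eq.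
      rewrite (linear_functional_eq f _ _ _ _ Hf eq_refl).
      rewrite (linear_functional_eq f (Rs w (scal w x)) zero (Rs w x) w Hf)
        by (etransitivity; [exact (linear_scal _ HRw w x)|module_eq]).
      rewrite (linear_functional_eq f zero zero zero (RtoC (-1)) Hf) by module_eq.
      generalize (f (Rs w x) : C) (f (Rs w (T x)) : C) (f zero : C). intros u v z. ring. }
    rewrite E, (Cpow_S w N). generalize (f (Rs w x) : C) (f (Rs w (T x)) : C). intros u v.
    transitivity (Re (Cplus (Cmult (Cpow w N) (Cminus (Cmult w u) v)) (Cmult (Cpow w N) v))).
    + f_equal. ring.
    + reflexivity.
  - apply (ex_RInt_continuous (V := R_CompleteNormedModule)). intros t _.
    apply (continuous_Re_angle (fun w => Cmult (Cpow w N) (f x)) r t _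
      (is_C_derivative_mult _ (fun _ => f x) _ _ _ (is_C_derivative_pow _ _)
         (is_C_derivative_const _ _))).
  - now apply (ex_RInt_moment T).
Qed.

(** Take norms in [l R x = x + T R x]. Without a division the estimate holds for every [l], and it
    has content once [Cmod l > M]. *)
Lemma resolvent_decay {X : CompleteNormedModule C_AbsRing} (T : X -> X) (l : C)
    (Rl : X -> X) (M : R) (x : X) :
  is_bounded_inverse (shifted l T) Rl -> (forall z, norm (T z) <= M * norm z) ->
  (Cmod l - M) * norm (Rl x) <= norm x.
Proof.
  intros (_ & _ & Hinv) HM.
  assert (E : scal l (Rl x) = plus x (T (Rl x))).
  { rewrite <- (Hinv x) at 2. unfold shifted. module_eq. }
  apply (norm_triangle_eq (X := X)) in E. rewrite norm_scal_complete in E.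
  pose proof (HM (Rl x)). lra.
Qed.

(* Cauchy's theorem at infinity: the integral does not depend on [r] and tends to 0. *)
Lemma moment_0_1 {X : CompleteNormedModule C_AbsRing} (T : X -> X)
    (Rs : C -> X -> X) (f : X -> C_NormedModule) (y : X) (r : R) :
  is_linear T -> resolvent_family T Rs -> is_linear f -> 1 < r ->
  moment Rs f 0 1 r y = 0.
Proof.
  intros HT HR Hf Hr.
  assert (Hder : forall s, 1 < s -> is_derive (fun s => moment Rs f 0 1 s y) s 0).
  { intros s Hs.
    set (G := fun w => Cmult (Cpow w 0) (f (op_pow (Rs w) 1 y))).
    set (d := fun w => Copp (f (op_pow (Rs w) 2 y)) : C).
    assert (HG : forall w, 1 < Cmod w -> is_C_derivative G w (d w)).
    { intros w Hw. pose proof (moment_integrand_derivative T Rs f 0 1 y w HR Hf Hw) as H.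
      replace (d w) with (Cplus (Cmult (Cmult (RtoC (INR 0)) (Cpow w (pred 0))) (f (op_pow (Rs w) 1 y)))
       (Cmult (Cpow w 0) (Copp (Cmult (RtoC (INR 1)) (f (op_pow (Rs w) (1 + 1) y)))))).
      - exact H.
      - unfold d. cbv beta. change (1 + 1)%nat with 2%nat.
        generalize (f (op_pow (Rs w) 1 y) : C) (f (op_pow (Rs w) 2 y) : C). intros u v.
        simpl. ring. }
    (* [g] is [w G'(w)], written as a multiple of the moment integrand with [N = 1] and [k = 2] so
       that its differentiability is already known. *)
    set (g := fun w => Cmult (Copp (RtoC 1)) (Cmult (Cpow w 1) (f (op_pow (Rs w) 2 y)))).
    assert (Hg : forall w, 1 < Cmod w -> exists e, is_C_derivative g w e).
    { intros w Hw. eexists.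
      exact (is_C_derivative_scal _ _ _ _ (moment_integrand_derivative T Rs f 1 2 y w HR Hf Hw)). }
    assert (Hgd : forall w, g w = Cmult (d w) w).
    { intros w. unfold g, d. cbv beta. generalize (f (op_pow (Rs w) 2 y) : C). intros v. simpl. ring. }
    assert (Hrad : forall u v, 1 < u ->
      is_derive (fun z => Re (G (circle_point z v))) u (/ u * Re (g (circle_point u v)))).
    { intros u v Hu.
      replace (/ u * Re (g (circle_point u v)))
        with (Re (Cmult (d (circle_point u v)) (cos v, sin v))).
      - apply is_derive_Re_radius, HG. now apply Cmod_circle_gt_1.
      - rewrite Hgd. generalize (d (circle_point u v)). intros e.
        rewrite circle_point_eq. unfold Re. simpl. field. lra. }
    assert (Hloc : locally s (fun z => 1 < z)) by (apply open_gt; exact Hs).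
    (* The radial derivative is [/ s] times the angular derivative of [Re (-i G)], whose integral
       over the circle is zero. *)
    assert (Hzero : RInt (fun t => Derive (fun u => Re (G (circle_point u t))) s) 0 (2 * PI) = 0).
    { transitivity (RInt (fun t => scal (/ s) (Re (g (circle_point s t)))) 0 (2 * PI)).
      { apply RInt_ext. intros t _. exact (is_derive_unique _ _ _ (Hrad s t Hs)). }
      assert (Hi : is_RInt (fun t => Re (g (circle_point s t))) 0 (2 * PI) 0).
      { set (d' := fun w : C => Cmult (Copp Ci) (d w)).
        assert (Ed : forall w, Cmult (d' w) (Cmult Ci w) = g w).
        { intros w. rewrite Hgd. unfold d'.
          transitivity (Cmult (Cmult Ci (Copp Ci)) (Cmult (d w) w)); [ring|].
          replace (Cmult Ci (Copp Ci)) with (RtoC 1)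
            by (apply injective_projections; simpl; ring). ring. }
        apply (is_RInt_ext
          (fun t => Re (Cmult (d' (circle_point s t)) (Cmult Ci (circle_point s t))))).
        { intros t _. now rewrite Ed. }
        apply (is_RInt_angle_derivative (fun w => Cmult (Copp Ci) (G w))).
        - intros t. apply is_C_derivative_scal, HG. now apply Cmod_circle_gt_1.
        - intros t. apply (continuous_ext (fun s0 => Re (g (circle_point s s0)))).
          { intros s0. now rewrite Ed. }
          destruct (Hg _ (Cmod_circle_gt_1 s t Hs)) as [e He].
          exact (continuous_Re_angle g s t e He). }
      apply (is_RInt_unique (V := R_CompleteNormedModule)).
      replace 0 with (scal (/ s) 0) at 2 by exact (Rmult_0_r (/ s)).
      now apply (is_RInt_scal (V := R_NormedModule)). }
    rewrite <- Hzero.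
    apply (is_derive_RInt_param (fun u t => Re (G (circle_point u t)))).
    - apply (filter_imp _ _) with (2 := Hloc). intros u Hu t _. eexists. now apply Hrad.
    - intros t _.
      apply (continuity_2d_pt_ext_loc (fun u v => / u * Re (g (circle_point u v)))).
      + apply locally_2d_locally.
        assert (Hl2 : locally (s, t) (fun z : R * R => 1 < fst z)).
        { apply (continuous_fst (U := R_UniformSpace) (V := R_UniformSpace) s t). exact Hloc. }
        apply (filter_imp _ _) with (2 := Hl2). intros [u v] Hu. symmetry.
        exact (is_derive_unique _ _ _ (Hrad u v Hu)).
      + apply continuity_2d_pt_mult.
        * apply continuity_2d_pt_inv; [apply continuity_2d_pt_id1|lra].
        * destruct (Hg _ (Cmod_circle_gt_1 s t Hs)) as [e He].
          exact (continuity_2d_Re_circle g s t e He).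
    - apply (filter_imp _ _) with (2 := Hloc). intros u Hu. now apply (ex_RInt_moment T). }
  assert (Hconst : forall s, r < s -> moment Rs f 0 1 r y = moment Rs f 0 1 s y).
  { intros s Hs. apply (eq_is_derive (V := R_NormedModule) (fun s => moment Rs f 0 1 s y)); [|exact Hs].
    intros t Ht. apply Hder. lra. }
  destruct (linear_norm _ HT) as [M [HM0 HM]].
  destruct (linear_functional_bound f Hf) as [Mf [HMf0 HMf]].
  assert (Hn : 0 <= norm y) by apply norm_ge_0.
  assert (Hbound : forall s, r < s -> M < s ->
    Rabs (moment Rs f 0 1 r y) * (s - M) <= 2 * PI * (Mf * norm y)).
  { intros s Hrs HMs. rewrite (Hconst s Hrs).
    assert (Hs1 : 1 < s) by lra.
    assert (Hle : Rabs (moment Rs f 0 1 s y) <= (2 * PI - 0) * (Mf * norm y / (s - M))).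
    { apply abs_RInt_le_const.
      - pose proof two_PI_pos; lra.
      - now apply (ex_RInt_moment T).
      - intros t _. eapply Rle_trans; [apply Re_le_Cmod|].
        rewrite Cmod_mult. simpl Cpow. rewrite Cmod_1, Rmult_1_l.
        eapply Rle_trans; [apply HMf|]. unfold Rdiv. rewrite Rmult_assoc.
        apply Rmult_le_compat_l; [lra|].
        pose proof (resolvent_decay T _ _ M y (HR _ (Cmod_circle_gt_1 s t Hs1)) HM) as H.
        rewrite Cmod_circle_point in H by lra.
        apply Rmult_le_reg_l with (s - M); [lra|].
        rewrite (Rmult_comm (norm y)), <- Rmult_assoc, Rinv_r, Rmult_1_l by lra. exact H. }
    apply Rmult_le_compat_r with (r := s - M) in Hle; [|lra].
    eapply Rle_trans; [exact Hle|]. apply Req_le. field. lra. }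
  destruct (Req_dec (moment Rs f 0 1 r y) 0) as [E|E]; [exact E|exfalso].
  apply Rabs_pos_lt in E. set (q := Rabs (moment Rs f 0 1 r y)) in *.
  set (B := 2 * PI * (Mf * norm y)) in *.
  assert (HB : 0 <= B).
  { unfold B. pose proof two_PI_pos. apply Rmult_le_pos; [lra|apply Rmult_le_pos; lra]. }
  assert (HBq : 0 <= B / q) by (apply Rdiv_le_0_compat; lra).
  (* At this radius the left side of the bound is [q * r + B + q], which exceeds [B]. *)
  specialize (Hbound (r + M + B / q + 1) ltac:(lra) ltac:(lra)).
  assert (H : q * (r + M + B / q + 1 - M) = q * r + B + q) by (field; lra).
  rewrite H in Hbound.
  assert (0 < q * r) by (apply Rmult_lt_0_compat; lra). lra.
Qed.

(* The coefficient of [l^-(n+1)] in the Laurent expansion of the resolvent. *)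
Lemma moment_coefficient {X : CompleteNormedModule C_AbsRing} (T : X -> X)
    (Rs : C -> X -> X) (f : X -> C_NormedModule) (n : nat) (x : X) (r : R) :
  is_linear T -> resolvent_family T Rs -> is_linear f -> 1 < r ->
  moment Rs f (S n) 1 r x = 2 * PI * Re (f (op_pow T n x)).
Proof.
  intros HT HR Hf Hr. revert x. induction n as [|n IH]; intros x.
  (* Only at exponent 0 does the integral of [l^N] survive; it contributes the factor [2 * PI]. *)
  - rewrite (moment_shift T), (moment_0_1 T), Rplus_0_r by assumption.
    rewrite (RInt_ext _ (fun _ => Re (f x))).
    + rewrite RInt_const. unfold scal; simpl; unfold mult; simpl.
      change (op_pow T 0 x) with x. ring.
    + intros t _. simpl Cpow. now rewrite Cmult_1_l.
  - rewrite (moment_shift T), (RInt_circle_pow (f x)), Rplus_0_l, IH by assumption.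
    now rewrite op_pow_S_r.
Qed.

(** * Estimates of the moments and conclusion *)

(** Iterating [moment_by_parts] produces the product [(n+1) ... (n+m)], of which only the lower
    bound [(n+1)^m] is kept. *)
Lemma moment_order_le {X : CompleteNormedModule C_AbsRing} (T : X -> X)
    (Rs : C -> X -> X) (f : X -> C_NormedModule) (n m : nat) (x : X) (r : R) :
  resolvent_family T Rs -> is_linear f -> 1 < r ->
  INR (S n) ^ m * Rabs (moment Rs f (S n) 1 r x)
  <= INR (fact m) * Rabs (moment Rs f (S n + m) (m + 1) r x).
Proof.
  intros HR Hf Hr. induction m as [|m IH].
  - rewrite Nat.add_0_r. simpl. lra.
  - pose proof (moment_by_parts T Rs f (S n + m) (m + 1) x r HR Hf Hr) as H.
    apply (f_equal Rabs) in H. rewrite !Rabs_mult, !(Rabs_right (INR _)) in H by apply Rle_ge, pos_INR.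
    replace (S n + S m)%nat with (S (S n + m)) by lia.
    replace (S m + 1)%nat with (m + 1 + 1)%nat by lia.
    replace (INR (fact (S m))) with (INR (fact m) * INR (m + 1)).
    + rewrite Rmult_assoc, H.
      apply Rmult_le_compat_l with (r := INR (S n)) in IH; [|apply pos_INR].
      rewrite <- Rmult_assoc in IH. change (INR (S n) * INR (S n) ^ m) with (INR (S n) ^ S m) in IH.
      eapply Rle_trans; [exact IH|].
      replace (INR (fact m) * (INR (S n + m) * Rabs (moment Rs f (S n + m) (m + 1) r x)))
        with (INR (S n + m) * (INR (fact m) * Rabs (moment Rs f (S n + m) (m + 1) r x))) by ring.
      apply Rmult_le_compat_r.
      * apply Rmult_le_pos; [apply pos_INR|apply Rabs_pos].
      * apply le_INR. lia.
    + rewrite <- mult_INR. f_equal. simpl. lia.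
Qed.

Lemma moment_abs_le {X : CompleteNormedModule C_AbsRing} (T : X -> X)
    (Rs : C -> X -> X) (f : X -> C_NormedModule) (N k : nat) (x : X) (r : R) :
  resolvent_family T Rs -> is_linear f -> 1 < r ->
  Rabs (moment Rs f N k r x)
  <= r ^ N * RInt (fun t => Cmod (f (op_pow (Rs (circle_point r t)) k x))) 0 (2 * PI).
Proof.
  intros HR Hf Hr.
  assert (Hc : ex_RInt (fun t => Cmod (f (op_pow (Rs (circle_point r t)) k x))) 0 (2 * PI)).
  { apply (ex_RInt_continuous (V := R_CompleteNormedModule)). intros t _.
    exact (continuous_Cmod_angle _ r t _
      (resolvent_power_derivative T Rs f k x _ HR Hf (Cmod_circle_gt_1 r t Hr))). }
  pose proof (RInt_correct (V := R_CompleteNormedModule) _ _ _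
    (ex_RInt_moment T Rs f N k x r HR Hf Hr)) as Hm.
  apply (RInt_correct (V := R_CompleteNormedModule)) in Hc.
  apply (is_RInt_scal (V := R_NormedModule) _ _ _ (r ^ N)) in Hc.
  pose proof two_PI_pos as Hpi.
  refine (norm_RInt_le (V := R_NormedModule) _ _ 0 (2 * PI) _ _ (Rlt_le _ _ Hpi) _ Hm Hc).
  intros t _. eapply Rle_trans; [apply Re_le_Cmod|]. rewrite Cmod_mult, Cmod_pow.
  rewrite Cmod_circle_point by lra. apply Rle_refl.
Qed.

Lemma pow_succ_inv_le_exp (n : nat) : (1 + / INR (S n)) ^ S n <= exp 1.
Proof.
  assert (Hn : 0 < INR (S n)) by (apply lt_0_INR; lia).
  assert (Hexp : forall (a : R) k, exp a ^ k = exp (INR k * a)).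
  { intros a k. induction k as [|k IH].
    - simpl. now rewrite Rmult_0_l, exp_0.
    - rewrite S_INR, Rmult_plus_distr_r, Rmult_1_l, exp_plus, <- IH. simpl. ring. }
  replace (exp 1) with (exp (/ INR (S n)) ^ S n).
  - apply pow_incr. split.
    + apply Rlt_le, Rplus_lt_0_compat; [lra|now apply Rinv_0_lt_compat].
    + apply exp_ineq1_le.
  - rewrite Hexp, Rinv_r by lra. reflexivity.
Qed.

(** Since [real] sends infinities to 0, finiteness has to be shown: [M] bounds the supremum above,
    and the value at [zero] bounds it below. *)
Lemma op_norm_le {U V : NormedModule C_AbsRing} (A : U -> V) (M : R) :
  (forall x, norm x <= 1 -> norm (A x) <= M) -> op_norm A <= M.
Proof.
  intros H. unfold op_norm.
  destruct (Lub_Rbar_correct (fun y => exists x : U, norm x <= 1 /\ y = norm (A x)))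
    as [Hub Hlub].
  set (l := Lub_Rbar _) in *.
  assert (Hle : Rbar_le l M).
  { apply Hlub. intros y (x & Hx & ->). now apply H. }
  assert (Hge : Rbar_le (norm (A zero)) l).
  { apply Hub. exists zero. split; [|reflexivity]. rewrite norm_zero. lra. }
  destruct l as [l| |]; simpl in *; [exact Hle|contradiction..].
Qed.

Lemma resolvent_familyP {X : CompleteNormedModule C_AbsRing} (T : X -> X) :
  (forall l : C, spectrum T l -> Cmod l <= 1) -> resolvent_family T (fun l => resolvent l T).
Proof.
  intros Hs l Hl. unfold resolvent. apply epsilon_spec.
  apply NNPP. intros Hn. specialize (Hs l Hn). lra.
Qed.

Theorem proposition2p3 (X : CompleteNormedModule C_AbsRing) (m : nat)
    (hm : (1 <= m)%nat) (T : X -> X) (hT : is_linear T) (hGFS : GFS m T) :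
  power_bounded T.
Proof.
  destruct hGFS as (Hs & K & HK & Hint).
  pose proof (resolvent_familyP T Hs) as HR.
  pose proof two_PI_pos as Hpi.
  (* [fact m] comes from [moment_order_le], [exp 1 * 2 ^ m] bounds [r ^ (S n + m)], [K] is the
     constant of the hypothesis, and [2 * PI] comes from [moment_coefficient]. *)
  exists (INR (fact m) * (exp 1 * 2 ^ m) * K / (2 * PI)). intros n _.
  apply op_norm_le. intros x Hx.
  destruct (hahn_banach_norming (op_pow T n x)) as (f & Hf & Hf1 & Hfx).
  assert (Hop : op_norm f <= 1).
  { apply op_norm_le. intros z Hz. exact (Rle_trans _ _ _ (Hf1 z) Hz). }
  assert (Hn : 0 < INR (S n)) by (apply lt_0_INR; lia).
  assert (Hinv : 0 < / INR (S n)) by now apply Rinv_0_lt_compat.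
  set (r := 1 + / INR (S n)).
  assert (Hr : 1 < r) by (unfold r; lra).
  assert (Hr2 : r <= 2).
  { assert (/ INR (S n) <= / 1).
    { apply Rinv_le_contravar; [lra|]. apply (le_INR 1). lia. }
    rewrite Rinv_1 in H. unfold r; lra. }
  pose proof (moment_order_le T _ f n m x r HR Hf Hr) as H1.
  pose proof (moment_abs_le T _ f (S n + m) (m + 1) x r HR Hf Hr) as H2.
  specialize (Hint r x f Hr Hf).
  rewrite (moment_coefficient T _ f n x r hT HR Hf Hr), Hfx in H1.
  set (I := RInt _ 0 (2 * PI)) in *.
  set (y := norm (op_pow T n x)) in *.
  assert (Hy : 0 <= y) by apply norm_ge_0.
  rewrite Rabs_right in H1 by (apply Rle_ge, Rmult_le_pos; lra).
  assert (Hpn : 0 < INR (S n) ^ m) by now apply pow_lt.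
  (* The factor [/ (r + 1)] is simply bounded by 1, and so are [norm x] and [op_norm f]. *)
  assert (HI : I <= K * INR (S n) ^ m).
  { apply Rle_trans with (1 := Hint).
    assert (HA : K / ((r + 1) * (r - 1) ^ m) <= K * INR (S n) ^ m).
    { replace (r - 1) with (/ INR (S n)) by (unfold r; ring). rewrite pow_inv.
      replace (K / ((r + 1) * / INR (S n) ^ m)) with (/ (r + 1) * (K * INR (S n) ^ m))
        by (field; split; lra).
      rewrite <- (Rmult_1_l (K * INR (S n) ^ m)) at 2.
      apply Rmult_le_compat_r; [apply Rmult_le_pos; lra|].
      rewrite <- Rinv_1. apply Rinv_le_contravar; lra. }
    assert (HA0 : 0 <= K / ((r + 1) * (r - 1) ^ m)).
    { apply Rdiv_le_0_compat; [lra|]. apply Rmult_lt_0_compat; [lra|]. apply pow_lt; lra. }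
    set (A := K / ((r + 1) * (r - 1) ^ m)) in *.
    assert (HAx : A * norm x <= A * 1) by now apply Rmult_le_compat_l.
    assert (HAx0 : 0 <= A * norm x) by (apply Rmult_le_pos; [exact HA0|apply norm_ge_0]).
    apply Rmult_le_compat_l with (r := A * norm x) in Hop; [|exact HAx0]. lra. }
  assert (Hpow : r ^ (S n + m) <= exp 1 * 2 ^ m).
  { rewrite pow_add. apply Rmult_le_compat.
    - apply pow_le; lra.
    - apply pow_le; lra.
    - apply pow_succ_inv_le_exp.
    - apply pow_incr; lra. }
  assert (H3 : r ^ (S n + m) * I <= exp 1 * 2 ^ m * (K * INR (S n) ^ m)).
  { assert (Hr0 : 0 <= r ^ (S n + m)) by (apply pow_le; lra).
    apply Rle_trans with (r ^ (S n + m) * (K * INR (S n) ^ m)).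
    - now apply Rmult_le_compat_l.
    - apply Rmult_le_compat_r; [apply Rmult_le_pos; lra|exact Hpow]. }
  apply Rle_trans with (1 := H2) in H3.
  apply Rmult_le_compat_l with (r := INR (fact m)) in H3; [|apply pos_INR].
  apply Rle_trans with (1 := H1) in H3.
  (* The power [(n+1)^m] now stands on both sides and cancels, leaving a bound free of [n]. *)
  apply Rmult_le_reg_l with (INR (S n) ^ m * (2 * PI)); [apply Rmult_lt_0_compat; lra|].
  replace (INR (S n) ^ m * (2 * PI) * (INR (fact m) * (exp 1 * 2 ^ m) * K / (2 * PI)))
    with (INR (fact m) * (exp 1 * 2 ^ m * (K * INR (S n) ^ m))) by (field; pose proof PI_neq0; lra).
  rewrite Rmult_assoc. exact H3.
Qed.
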